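(* Let $X$ be a metric space, $a,b\in X$, and $\ell>0$. Suppose $d(a,b)\le\ell$. Then the pair $(|\Delta\mathrm{Cau}^\ell_{\mathrm{ess}}(X;a,b)|,|\Delta'\mathrm{Cau}^\ell_{\mathrm{ess}}(X;a,b)|)$ is homotopy equivalent to the double suspension $$\Sigma^2\bigl(|K_\ell(X;a,b)|,|K'_\ell(X;a,b)|\bigr).$$ In particular, $$\mathrm{MH}^\ell_k(X;a,b)\cong H_{k-2}\bigl(|K_\ell(X;a,b)|,|K'_\ell(X;a,b)|\bigr)$$ for all $k\ge 0$.
   Context: For points $x_0,\dots,x_n$ of a metric space write $d(x_0,\dots,x_n)=\sum_{i=1}^n d(x_{i-1},x_i)$. Magnitude homology. $\mathrm{MC}^\ell_k(X;a,b)$ is the free abelian group on tuples $(x_0,\dots,x_k)\in X^{k+1}$ with $x_{i-1}\ne x_i$, $x_0=a$, $x_k=b$, $d(x_0,\dots,x_k)=\ell$; the differential is $\partial=\sum_{i=1}^{k-1}(-1)^i\partial_i$, where $\partial_i$ deletes $x_i$ if the resulting tuple still has length $\ell$ and is $0$ otherwise. $\mathrm{MH}^\ell_k(X;a,b)=H_k(\mathrm{MC}^\ell_*(X;a,b))$. Causal posets. The causal order on $X\times\mathbb{R}$ is $(x,t)\le(x',t')$ iff $d(x,x')\le t'-t$. $\mathrm{Cau}^\ell(X;a,b)=\{(x,t)\in X\times[0,\ell]\mid d(a,x)\le t,\ d(x,b)\le\ell-t\}$. $\Delta P$ denotes the order complex of a poset $P$ (simplices are finite chains). $\Delta'\mathrm{Cau}^\ell(X;a,b)$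 is the subcomplex of chains $(x_0,t_0)<\dots<(x_n,t_n)$ with $d(x_0,\dots,x_n)<\ell$. A chain $((x_0,t_0),\dots,(x_n,t_n))$ in $\mathrm{Cau}^\ell(X;a,b)$ is light-like of length $\ell$ from $a$ to $b$ if $t_0=0$, $t_n=\ell$ and $d(x_{i-1},x_i)=t_i-t_{i-1}$ for $1\le i\le n$. $\mathrm{Cau}^\ell_{\mathrm{ess}}(X;a,b)\subseteq\mathrm{Cau}^\ell(X;a,b)$ is the subposet of points lying in some light-like sequence of length $\ell$ from $a$ to $b$, and $\Delta'\mathrm{Cau}^\ell_{\mathrm{ess}}(X;a,b)=\Delta\mathrm{Cau}^\ell_{\mathrm{ess}}(X;a,b)\cap\Delta'\mathrm{Cau}^\ell(X;a,b)$. Empty complex and void. Here simplicial complexes may contain the empty simplex $\emptyset$ (dimension $-1$). The empty simplicial complex is $\{\emptyset\}$; it is a subcomplex of every complex other than the void. The void, $\mathbf{void}$, is the complex with no simplices at all. $C_*(S)$ is the augmented chain complex, with $C_{-1}(S)\cong\mathbb{Z}$ generated by $\emptyset$ if $\emptyset\in S$, and $C_*(\mathbf{void})=0$. For a pair, $H_*(|S|,|S'|)$ is the homology of $C_*(S)/C_*(S')$. The Asao–Izumihara type pair. $\mathcal{K}^\ell(X;a,b)=\mathrm{Cau}^\ell_{\mathrm{ess}}(X;a,b)\setminus\{(a,0),(b,\ell)\}$. $K_\ell(X;a,b)=\Delta\mathcal{K}^\ell(X;a,b)$ (including the empty simplex) when $d(a,b)\le\ell$; so it is $\{\emptyset\}$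 if $\mathcal{K}^\ell(X;a,b)=\emptyset$; it is $\mathbf{void}$ if $d(a,b)>\ell$. $K'_\ell(X;a,b)$ consists of the simplices $((x_0,t_0),\dots,(x_k,t_k))\in K_\ell(X;a,b)$ with $d(a,x_0,\dots,x_k,b)<\ell$; it is $\mathbf{void}$ if $d(a,b)\ge\ell$, and if $d(a,b)<\ell$ it contains the empty simplex (so it is $\{\emptyset\}$ when there are no other simplices). Suspension of a pair. For a complex $S$, $\Gamma_\alpha(S)=\{\alpha\}*S$ is the cone with apex $\alpha$, with $\Gamma_\alpha(\mathbf{void})=\mathbf{void}$ and $\Gamma_\alpha(\{\emptyset\})=\{\alpha\}$. The suspension of a pair is $\Sigma(S,A)=(\Gamma_\alpha(S),\ \Gamma_\alpha(A)\cup S)$, and $\Sigma^2=\Sigma\circ\Sigma$. (For instance $\Sigma(\{\emptyset\},\mathbf{void})=(\{\alpha\},\{\emptyset\})$ and $\Sigma^2(\{\emptyset\},\mathbf{void})=([0,1],\{0,1\})$.) Degenerate case convention. A pair $(S,A)$ represents the pointed quotient $S/A$, with $\emptyset/\emptyset=\{*\}$. When $\mathrm{Cau}^\ell_{\mathrm{ess}}(X;a,b)=\emptyset$ (so $K_\ell=K'_\ell=\{\emptyset\}$), ''homotopy equivalent'' means that the pointed quotients of the two pairs are homotopy equivalent (both being trivial). *)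

(* Defs.v *)
From HB Require Import structures.
From mathcomp Require Import all_boot all_order all_algebra.
From mathcomp Require Import finmap zify freeg.
From mathcomp Require Import all_classical all_reals all_analysis.

Set Implicit Arguments.
Unset Strict Implicit.
Unset Printing Implicit Defensive.

Import Order.TTheory GRing.Theory Num.Theory.
Import numFieldNormedType.Exports.

Local Open Scope classical_set_scope.
Local Open Scope ring_scope.

Definition isomorphic_groups (A B : zmodType) : Prop :=
  exists f : {additive A -> B}, bijective f.

(* [differential i j] vanishes unless [j = i - 1]; taking both degrees as
   arguments avoids transports along [n + 1 - 1 = n]. *)
Record chain_complex := ChainComplex {
  chain_group :> int -> zmodType;
  differential : forall i j, {additive chain_group i -> chain_group j};
  diff_shape : forall i j x, j <> i - 1 -> differential i j x = 0;
  diff_diff : forall i j k x, differential j k (differential i j x) = 0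
}.

Section Homology.
Variables (C : chain_complex) (n : int).

Definition cycles : {pred C n} := [pred x | differential C n (n - 1) x == 0].

Lemma cycles_zmod_closed : zmod_closed cycles.
Proof.
split=> [|x y]; rewrite !inE ?raddf0// => /eqP x0 /eqP y0.
by rewrite raddfB x0 y0 subrr.
Qed.
HB.instance Definition _ :=
  GRing.isZmodClosed.Build (C n) cycles cycles_zmod_closed.

Definition cycle_group := {x : C n | x \in cycles}.
HB.instance Definition _ := SubChoice.on cycle_group.
HB.instance Definition _ := [SubChoice_isSubZmodule of cycle_group by <:].

Definition boundaries : {pred cycle_group} :=
  [pred z | `[< exists y : C (n + 1), differential C (n + 1) n y = \val z >]].

Lemma boundaries_zmod_closed : zmod_closed boundaries.
Proof.
split=> [|x y].
  by apply/asboolP; exists 0; rewrite !raddf0.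
rewrite !unfold_in.
move=> /asboolP[u ux] /asboolP[v vy]; apply/asboolP; exists (u - v).
by rewrite !raddfB ux vy.
Qed.
HB.instance Definition _ :=
  GRing.isZmodClosed.Build cycle_group boundaries boundaries_zmod_closed.

Definition homology : zmodType := ring_quotient.Quotient.quot boundaries.

End Homology.

Section QuotientComplex.
Local Open Scope quotient_scope.
Variables (C : chain_complex) (B : forall n, zmodClosed (C n)).
Hypothesis diffB : forall i j x, x \in B i -> differential C i j x \in B j.

Local Notation quotient_group n := (ring_quotient.Quotient.quot (B n)).

Definition quotient_diff i j (x : quotient_group i) : quotient_group j :=
  \pi_(quotient_group j) (differential C i j (repr x)).

Lemma quotient_diff_pi i j x :
  quotient_diff j (\pi_(quotient_group i) x) =
  \pi_(quotient_group j) (differential C i j x).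
Proof.
apply/eqP; rewrite /quotient_diff -ring_quotient.Quotient.idealrBE -raddfB.
by apply: diffB; rewrite ring_quotient.Quotient.idealrBE reprK.
Qed.

Lemma quotient_diff_zmod i j : zmod_morphism (@quotient_diff i j).
Proof.
move=> x y; rewrite -[x]reprK -[y]reprK -raddfB !quotient_diff_pi.
by rewrite -raddfB -raddfB.
Qed.
HB.instance Definition _ i j := GRing.isZmodMorphism.Build
  (quotient_group i) (quotient_group j) (@quotient_diff i j)
  (@quotient_diff_zmod i j).

Lemma quotient_diff_shape i j (x : quotient_group i) :
  j <> i - 1 -> quotient_diff j x = 0.
Proof. by move=> ji; rewrite /quotient_diff diff_shape// raddf0. Qed.

Lemma quotient_diff_diff i j k (x : quotient_group i) :
  quotient_diff k (quotient_diff j x) = 0.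
Proof. by rewrite -[x]reprK !quotient_diff_pi diff_diff raddf0. Qed.

Definition quotient_complex : chain_complex :=
  @ChainComplex (fun n => quotient_group n) (fun i j => @quotient_diff i j)
    quotient_diff_shape quotient_diff_diff.

End QuotientComplex.

Definition delete (T : Type) (i : nat) (s : seq T) : seq T :=
  take i s ++ drop i.+1 s.

Lemma size_delete (T : Type) i (s : seq T) :
  (i < size s)%N -> size (delete i s) = (size s).-1.
Proof. by move=> i_s; rewrite size_cat size_takel 1?ltnW// size_drop; lia. Qed.

Lemma nth_delete (T : Type) (x0 : T) i (s : seq T) k :
  nth x0 (delete i s) k = nth x0 s (if (k < i)%N then k else k.+1).
Proof.
rewrite nth_cat size_take_min; case: (ltnP k i) => ki.
  case: ltnP => ks; first by rewrite nth_take.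
  by rewrite !nth_default// ?size_drop; lia.
by rewrite ltnNge geq_min ki/= nth_drop; case: (leqP i (size s)) => si;
  [congr nth; lia | rewrite !nth_default//; lia].
Qed.

Lemma delete_delete (T : Type) (p q : nat) (s : seq T) :
  (p < q < size s)%N -> delete p (delete q s) = delete q.-1 (delete p s).
Proof.
move=> pqs; case: s pqs => [|x0 s']; first by rewrite ltn0 andbF.
set s := x0 :: s' => pqs; apply: (@eq_from_nth _ x0).
  by rewrite !size_delete; lia.
move=> k _; rewrite !nth_delete; congr nth.
by case: (ltnP k p) => h1; case: (ltnP k q.-1) => h2;
  case: ltnP => h3; case: ltnP => h4; lia.
Qed.

Lemma sum_antisym (M : zmodType) (f : nat -> nat -> M) (m n : nat) :
  (m <= n)%N -> (forall q p, (p < q <= n)%N -> f q p = - f p q.-1) ->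
  \sum_(m <= q < n.+1) \sum_(m <= p < n) f q p = 0.
Proof.
elim: n => [|n IHn] mn fN; first by rewrite big1// => q _; rewrite big_geq.
have [{}mn|mn'] := leqP m n; last first.
  by rewrite big1// => q _; rewrite big_geq//; lia.
rewrite big_nat_recr/=; last by lia.
under eq_bigr => q _ do rewrite big_nat_recr//=.
rewrite big_split/= IHn// ?add0r; last by move=> q p ?; apply: fN; lia.
rewrite -big_split/= big_nat big1// => q qn.
by rewrite (fN n.+1 q) ?subrr//; lia.
Qed.

(* The complex whose degree-[n] part is freely generated by the sequences of
   length [n + 1] satisfying [G]; the differential of [s] is the alternating sum
   of the [delete p s], those failing [G] counting as 0, and the [m] first and
   the [m] last entries of [s] are never deleted. *)
Section AlternatingComplex.
Variables (T : choiceType) (G : pred (seq T)) (m : nat).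
Hypothesis G_mid : forall s p q, G s -> (m <= q < size s - m)%N ->
  (m <= p < (size s).-1 - m)%N -> G (delete p (delete q s)) -> G (delete q s).

Definition generator (n : int) := {s : seq T | G s && ((size s)%:Z == n + 1)}.
HB.instance Definition _ n := Choice.on (generator n).

Definition seq_chain n (s : seq T) : {freeg (generator n)} :=
  if insub s is Some g then << g >> else 0.

Definition generator_diff i j (g : generator i) : {freeg (generator j)} :=
  \sum_(m <= p < size (val g) - m) (-1) ^+ p *: seq_chain j (delete p (val g)).

Definition alt_diff i j : {freeg (generator i)} -> {freeg (generator j)} :=
  fglift (@generator_diff i j).

Lemma alt_diff_zmod i j : zmod_morphism (@alt_diff i j).
Proof. exact: lift_is_additive. Qed.
HB.instance Definition _ i j := GRing.isZmodMorphism.Build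
  {freeg (generator i)} {freeg (generator j)} (@alt_diff i j)
  (@alt_diff_zmod i j).

Lemma alt_diffE i j c :
  alt_diff j c = \sum_(g <- dom c) coeff g c *: @generator_diff i j g.
Proof.
rewrite -{1}[c]freeg_sumE raddf_sum/=; apply: eq_bigr => g _.
by rewrite /alt_diff liftU.
Qed.

Lemma alt_diffZ i j (k : int) c : @alt_diff i j (k *: c) = k *: alt_diff j c.
Proof. by rewrite -[k]intz !scaler_int raddfMz. Qed.

Lemma alt_diff_shape i j (c : {freeg (generator i)}) :
  j <> i - 1 -> alt_diff j c = 0.
Proof.
move=> ji; rewrite alt_diffE big1// => g _.
rewrite /generator_diff big_nat big1 ?scaler0// => p pg.
rewrite /seq_chain insubF ?scaler0//; apply/negP => /andP[_ /eqP].
have /andP[_ /eqP szg] := valP g; rewrite size_delete; last by lia.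
move: (size _) szg pg => N szg pg; lia.
Qed.

Lemma alt_diff_seq_chain i k (s : seq T) :
  (forall p, (m <= p < (size s) - m)%N -> G (delete p s) -> G s) ->
  (size s)%:Z = i + 1 ->
  alt_diff k (seq_chain i s) =
  \sum_(m <= p < size s - m) (-1) ^+ p *: seq_chain k (delete p s).
Proof.
move=> Gs szs; rewrite {1}/seq_chain; case: insubP => [g _ gs|/= Ns].
  by rewrite /alt_diff liftU scale1r /generator_diff gs.
rewrite raddf0 big_nat big1// => p ps; rewrite /seq_chain insubF ?scaler0//.
apply/negP => /andP[Gp _]; move/negP: Ns; apply.
by rewrite (Gs _ ps Gp)/= szs.
Qed.

Lemma alt_diff_diff i j k (c : {freeg (generator i)}) :
  alt_diff k (alt_diff j c) = 0.
Proof.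
have [ji|/eqP ji] := eqVneq j (i - 1); last first.
  by rewrite [alt_diff j c]alt_diff_shape// raddf0.
rewrite (alt_diffE j c) raddf_sum big1// => -[s Hs] _ /=.
rewrite alt_diffZ [alt_diff _ _](_ : _ = 0) ?scaler0//.
have /andP[Gs /eqP ss] := Hs.
rewrite /generator_diff raddf_sum/=.
set N := size s in ss *.
pose f q p := (-1) ^+ (q + p) *: seq_chain k (delete p (delete q s)).
transitivity (\sum_(m <= q < N - m) \sum_(m <= p < N.-1 - m) f q p).
  apply: eq_big_nat => q qs; rewrite alt_diffZ alt_diff_seq_chain.
  - rewrite scaler_sumr size_delete; last by lia.
    by apply: eq_bigr => p _; rewrite scalerA /f exprD.
  - by move=> p; rewrite size_delete -/N => [ps|]; [apply: G_mid | lia].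
  - by rewrite size_delete -/N; lia.
have [N0|N0] := posnP N; first by rewrite N0 big_geq.
have [mN|Nm] := leqP m (N.-1 - m); last first.
  by rewrite big1// => q _; rewrite big_geq// ltnW.
rewrite (_ : (N - m)%N = (N.-1 - m).+1); last by lia.
apply: sum_antisym => // -[//|q] p pq; rewrite /f delete_delete; last by lia.
by rewrite -scaleNr addSn exprS mulN1r [(p + _)%N]addnC.
Qed.

Definition alt_complex : chain_complex :=
  @ChainComplex (fun n => {freeg (generator n)}) (fun i j => @alt_diff i j)
    alt_diff_shape alt_diff_diff.

End AlternatingComplex.

Lemma delete_subseq (T : eqType) i (s : seq T) : subseq (delete i s) s.
Proof.
elim: s i => [|x s IH] [|i] //.
  by rewrite /delete take0 cat0s drop1; exact: subseq_cons.
by rewrite /delete /= eqxx; exact: IH.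
Qed.

(* Abstract simplicial complexes; the empty set of vertices may be a simplex. *)
Record complex (V : choiceType) := Complex {
  simplices : set {fset V};
  face_closed : forall s t : {fset V},
    (t `<=` s)%fset -> simplices s -> simplices t
}.

Record complex_pair (V : choiceType) := ComplexPair {
  pair_total : complex V;
  pair_sub : complex V;
  pair_sub_total : simplices pair_sub `<=` simplices pair_total
}.

Section Realization.
Variables (R : realType) (V : choiceType) (S : complex V).

Record realization := Realization {
  bary : V -> R;
  _ : exists2 s : {fset V}, simplices S s &
    [/\ forall v, 0 <= bary v, forall v, v \notin s -> bary v = 0 &
        \sum_(v <- s) bary v = 1]
}.

HB.instance Definition _ := gen_eqMixin realization.
HB.instance Definition _ := gen_choiceMixin realization.

Definition cell (s : {fset V}) : set realization :=
  [set x | forall v, v \notin s -> bary x v = 0].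

(* The weak topology: [U] is open when its trace on each closed simplex is open
   for the Euclidean topology of that simplex. *)
Definition realization_open (U : set realization) : Prop :=
  forall s, simplices S s -> forall x, U x -> cell s x ->
    exists2 e : R, 0 < e & forall y, cell s y ->
      (forall v, v \in s -> `|bary x v - bary y v| < e) -> U y.

Lemma realization_openT : realization_open setT.
Proof. by move=> s _ x _ _; exists 1. Qed.

Lemma realization_openI : setI_closed realization_open.
Proof.
move=> U W oU oW s Ss x [Ux Wx] sx.
have [e e0 eU] := oU s Ss x Ux sx; have [d d0 dW] := oW s Ss x Wx sx.
exists (Num.min e d); first by rewrite lt_min e0.
move=> y sy xy; split; [apply: eU | apply: dW] => // v /xy.
  by rewrite lt_min => /andP[].
by rewrite lt_min => /andP[].
Qed.

Lemma realization_open_bigcup (I : Type) (f : I -> set realization) :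
  (forall i, realization_open (f i)) -> realization_open (\bigcup_i f i).
Proof.
move=> fo s Ss x [i _ fx] sx; have [e e0 ef] := fo i s Ss x fx sx.
by exists e => // y sy xy; exists i => //; apply: ef.
Qed.

HB.instance Definition _ := isOpenTopological.Build realization
  realization_openT realization_openI realization_open_bigcup.

End Realization.

Record space_pair := SpacePair {
  space :> topologicalType;
  subspace_of : set space
}.

Definition realization_pair (R : realType) (V : choiceType)
    (K : complex_pair V) : space_pair :=
  SpacePair [set x : realization R (pair_total K) |
    exists2 s, simplices (pair_sub K) s & cell s x].

Definition pair_map (P Q : space_pair) (f : P -> Q) : Prop :=
  continuous f /\ (f @` @subspace_of P `<=` @subspace_of Q).

Definition pair_homotopic (R : realType) (P Q : space_pair) (f g : P -> Q) :=
  exists h : P * R -> Q,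
    [/\ {within [set: P] `*` `[0, 1], continuous h},
        forall x, h (x, 0) = f x,
        forall x, h (x, 1) = g x &
        forall x t, @subspace_of P x -> 0 <= t <= 1 ->
          @subspace_of Q (h (x, t))].

Definition pair_homotopy_equivalent (R : realType) (P Q : space_pair) : Prop :=
  exists (f : P -> Q) (g : Q -> P),
    [/\ pair_map f, pair_map g,
        pair_homotopic R (g \o f) id & pair_homotopic R (f \o g) id].

(* The quotient [T / A] as the points outside [A] together with a base point
   [None]; in particular [T / set0] is [T] with an isolated point added. *)
Section PointedQuotient.
Variables (T : topologicalType) (A : set T).

Definition collapse : Type := option {x : T | x \notin A}.
HB.instance Definition _ := Choice.on collapse.

Definition collapse_proj (x : T) : collapse := insub x.

Definition collapse_open (U : set collapse) : Prop :=
  open (collapse_proj @^-1` U).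

Lemma collapse_openT : collapse_open setT.
Proof. by rewrite /collapse_open preimage_setT; exact: openT. Qed.

Lemma collapse_openI : setI_closed collapse_open.
Proof.
by move=> U W oU oW; rewrite /collapse_open preimage_setI; exact: openI.
Qed.

Lemma collapse_open_bigcup (I : Type) (f : I -> set collapse) :
  (forall i, collapse_open (f i)) -> collapse_open (\bigcup_i f i).
Proof.
move=> fo; rewrite /collapse_open preimage_bigcup; apply: bigcup_open => i _.
exact: fo.
Qed.

HB.instance Definition _ := isOpenTopological.Build collapse
  collapse_openT collapse_openI collapse_open_bigcup.

End PointedQuotient.

Definition pointed_quotient (P : space_pair) : space_pair :=
  @SpacePair (collapse (@subspace_of P)) [set None].

(* In the suspension of a complex on [V], [None] is the apex and [Some] embeds
   the base. *)
Section Suspension.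
Variable V : choiceType.

Definition base (s : {fset V}) : {fset option V} := (Some @` s)%fset.

Lemma sub_base (s : {fset V}) (u : {fset option V}) :
  (u `<=` base s)%fset -> exists2 t : {fset V}, (t `<=` s)%fset & u = base t.
Proof.
move=> /fsubsetP us; exists [fset v in s | Some v \in u]%fset.
  by apply/fsubsetP => v; rewrite !inE => /andP[].
apply/fsetP => w; apply/idP/imfsetP => /=.
  move=> wu; have /imfsetP[v /= vs wv] := us _ wu.
  by exists v; rewrite // !inE vs -wv.
by move=> [v]; rewrite !inE => /andP[_ vu] ->.
Qed.

Definition embed_simplices (S : complex V) : set {fset option V} :=
  [set u | exists2 s : {fset V}, simplices S s & u = base s].

Lemma embed_closed S (s t : {fset option V}) :
  (t `<=` s)%fset -> embed_simplices S s -> embed_simplices S t.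
Proof.
move=> ts [u Su su]; move: ts; rewrite su => /sub_base[w wu ->].
by exists w => //; exact: face_closed wu Su.
Qed.

Definition embed (S : complex V) : complex (option V) :=
  Complex (@embed_closed S).

Definition cone_simplices (S : complex V) : set {fset option V} :=
  [set u | exists2 s : {fset V}, simplices S s &
             u = base s \/ u = (None |` base s)%fset].

Lemma cone_closed S (s t : {fset option V}) :
  (t `<=` s)%fset -> cone_simplices S s -> cone_simplices S t.
Proof.
move=> ts [u Su su].
have : (t `\ None `<=` base u)%fset.
  apply/fsubsetP => x; rewrite !inE => /andP[xN /(fsubsetP ts)].
  by case: su => ->//; rewrite !inE (negbTE xN).
move=> /sub_base[w wu tw]; exists w; first exact: face_closed wu Su.
rewrite -tw; have [tN|tN] := boolP (None \in t).
  by right; rewrite fsetD1K.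
by left; rewrite mem_fsetD1.
Qed.

Definition cone (S : complex V) : complex (option V) :=
  Complex (@cone_closed S).

End Suspension.

Section Union.
Variables (V : choiceType) (S T : complex V).

Lemma union_closed (s t : {fset V}) : (t `<=` s)%fset ->
  (simplices S `|` simplices T) s -> (simplices S `|` simplices T) t.
Proof.
by move=> ts [/(face_closed ts)|/(face_closed ts)]; [left | right].
Qed.

Definition union_complex : complex V := Complex union_closed.

Lemma inter_closed (s t : {fset V}) : (t `<=` s)%fset ->
  (simplices S `&` simplices T) s -> (simplices S `&` simplices T) t.
Proof. by move=> ts [/(face_closed ts) ? /(face_closed ts) ?]; split. Qed.

Definition inter_complex : complex V := Complex inter_closed.

End Union.

Section SuspensionPair.
Variables (V : choiceType) (K : complex_pair V).

Lemma suspension_sub :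
  simplices (union_complex (cone (pair_sub K)) (embed (pair_total K))) `<=`
  simplices (cone (pair_total K)).
Proof.
move=> u [[s /pair_sub_total Ss us]|[s Ss us]]; first by exists s.
by exists s => //; left.
Qed.

Definition suspension : complex_pair (option V) := ComplexPair suspension_sub.

End SuspensionPair.

Section OrderComplex.
Variables (d : Order.disp_t) (P : porderType d).

Definition order_simplices (A : set P) : set {fset P} :=
  [set s | (forall x, x \in s -> A x) /\ {in s &, forall x y, (x >=< y)%O}].

Lemma order_simplices_closed A (s t : {fset P}) :
  (t `<=` s)%fset -> order_simplices A s -> order_simplices A t.
Proof.
move=> /fsubsetP ts [sA sc]; split=> [x /ts/sA //|x y /ts xs /ts ys].
exact: sc.
Qed.

Definition order_complex (A : set P) : complex P :=
  Complex (@order_simplices_closed A).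

(* The augmented chain complex of a subcomplex [S] of an order complex: the
   generators are the simplices of [S] listed in increasing order. *)
Definition vertices (s : seq P) : {fset P} := [fset x in s]%fset.

Lemma in_vertices s x : (x \in vertices s) = (x \in s).
Proof. by rewrite !inE. Qed.

Section Chains.
Variable S : complex P.

Definition ordered_simplex : pred (seq P) :=
  [pred s | sorted <%O s && `[< simplices S (vertices s) >]].

Lemma vertices_delete i (s : seq P) :
  (vertices (delete i s) `<=` vertices s)%fset.
Proof.
apply/fsubsetP => x; rewrite !in_vertices.
exact: (mem_subseq (delete_subseq i s)).
Qed.

Lemma ordered_simplex_delete i s :
  ordered_simplex s -> ordered_simplex (delete i s).
Proof.
move=> /andP[ss /asboolP Ss]; apply/andP; split.
  by apply: subseq_sorted ss; [exact: lt_trans | exact: delete_subseq].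
by apply/asboolP; apply: face_closed Ss; exact: vertices_delete.
Qed.

Lemma ordered_simplex_mid s p q : ordered_simplex s ->
  (0 <= q < size s - 0)%N -> (0 <= p < (size s).-1 - 0)%N ->
  ordered_simplex (delete p (delete q s)) -> ordered_simplex (delete q s).
Proof. by move=> /(ordered_simplex_delete q). Qed.

Definition simplicial_chains : chain_complex :=
  alt_complex (m := 0) ordered_simplex_mid.

End Chains.

Section RelativeChains.
Variable K : complex_pair P.
Local Notation C := (simplicial_chains (pair_total K)).

Definition sub_chains (n : int) :
    {pred {freeg (generator (ordered_simplex (pair_total K)) n)}} :=
  [pred c | all (fun g => `[< simplices (pair_sub K) (vertices (val g)) >])
                (dom c)].
Arguments sub_chains : clear implicits.

Lemma sub_chainsP n
    (c : {freeg (generator (ordered_simplex (pair_total K)) n)}) :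
  reflect (forall g, g \in dom c -> simplices (pair_sub K) (vertices (val g)))
          (c \in sub_chains n).
Proof.
by apply: (iffP allP) => H g /H; [move/asboolP | move=> ?; apply/asboolP].
Qed.

Lemma sub_chains_zmod_closed n : zmod_closed (sub_chains n).
Proof.
split=> [|x y /sub_chainsP xK /sub_chainsP yK]; apply/sub_chainsP => g.
  by rewrite dom0.
by move=> /domB; rewrite mem_cat => /orP[/xK|/yK].
Qed.
HB.instance Definition _ n := GRing.isZmodClosed.Build
  {freeg (generator (ordered_simplex (pair_total K)) n)} (sub_chains n)
  (sub_chains_zmod_closed n).

Lemma sub_chainsZ n (k : int) c : c \in sub_chains n -> k *: c \in sub_chains n.
Proof.
by move=> /sub_chainsP cK; apply/sub_chainsP => g /domZ_subset; exact: cK.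
Qed.

Lemma sub_chains_diff i j (c : C i) :
  c \in sub_chains i -> differential C i j c \in sub_chains j.
Proof.
move=> /sub_chainsP cK; rewrite /= alt_diffE big_seq rpred_sum// => g /cK gK.
apply: sub_chainsZ; rewrite /generator_diff rpred_sum// => p _.
apply: sub_chainsZ; rewrite /seq_chain; case: insubP => [h _ hE|_].
  apply/sub_chainsP => k; rewrite domU1 inE => /eqP ->; rewrite hE.
  by apply: face_closed gK; exact: vertices_delete.
exact: rpred0.
Qed.

Definition relative_chains : chain_complex :=
  @quotient_complex C (fun n => sub_chains n) sub_chains_diff.

Definition relative_homology (n : int) : zmodType := homology relative_chains n.

End RelativeChains.

End OrderComplex.

Section TotalDistance.
Variables (R : realType) (X : metricType R).

Definition total_dist (s : seq X) : R :=
  if s is x :: s' then \sum_(r <- pairmap mdist x s') r else 0.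

Arguments total_dist : simpl never.

Lemma total_dist1 x : total_dist [:: x] = 0.
Proof. by rewrite /total_dist big_nil. Qed.

Lemma total_dist_cons2 x y s :
  total_dist (x :: y :: s) = mdist x y + total_dist (y :: s).
Proof. by rewrite /total_dist/= big_cons. Qed.

Lemma total_dist_ge0 s : 0 <= total_dist s.
Proof.
case: s => // x s; elim: s x => [x|y s IH x]; first by rewrite total_dist1.
by rewrite total_dist_cons2 addr_ge0// mdist_ge0.
Qed.

Lemma total_dist_cons_skip x y s :
  total_dist (x :: s) <= mdist x y + total_dist (y :: s).
Proof.
case: s => [|z s]; first by rewrite !total_dist1 addr0 mdist_ge0.
rewrite !total_dist_cons2 addrA lerD2r; exact: metric_triangle.
Qed.

Lemma total_dist_le_cons x s : total_dist s <= total_dist (x :: s).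
Proof.
case: s => [|y s]; first exact: total_dist_ge0.
by rewrite total_dist_cons2 lerDr mdist_ge0.
Qed.

Lemma total_dist_subseq_cons x s t :
  subseq s t -> total_dist (x :: s) <= total_dist (x :: t).
Proof.
elim: t x s => [|z t IH] x [|w s]//.
  by rewrite total_dist1 total_dist_ge0.
move=> /=; have [->|_] := eqVneq w z => st.
  by rewrite !total_dist_cons2 lerD2l IH.
by rewrite (le_trans (IH x _ st))// total_dist_cons2 total_dist_cons_skip.
Qed.

Lemma total_dist_subseq s t : subseq s t -> total_dist s <= total_dist t.
Proof.
elim: t s => [|y t IH] [|x s]//; first by rewrite total_dist_ge0.
move=> /=; have [->|_ st] := eqVneq; first exact: total_dist_subseq_cons.
exact: le_trans (IH _ st) (total_dist_le_cons _ _).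
Qed.

Definition magnitude_simplex (l : R) (a b : X) : pred (seq X) :=
  fun s => if s is x :: s' then
    [&& x == a, last x s' == b, path (fun y z => y != z) x s' &
        total_dist s == l]
  else false.

Lemma path_delete x s q : (q.+1 < size s)%N ->
  path (fun y z => y != z) x s ->
  total_dist (x :: delete q s) = total_dist (x :: s) ->
  path (fun y z => y != z) x (delete q s).
Proof.
elim: s x q => [|y s IH] x [|q]//=.
  rewrite /delete take0 cat0s drop1 /=.
  case: s {IH} => //= z s _ /and3P[xy yz zs]; rewrite zs andbT.
  rewrite !total_dist_cons2 addrA => /addIr xyz.
  by rewrite -mdist_gt0 xyz addr_gt0// mdist_gt0.
rewrite ltnS => qs /andP[xy ys].
rewrite -[delete _ _]/(y :: delete q s) !total_dist_cons2 => /addrI.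
by rewrite /= xy; exact: IH.
Qed.

Lemma last_delete (x : X) s q :
  (q.+1 < size s)%N -> last x (delete q s) = last x s.
Proof.
by move=> qs; rewrite /delete last_cat -[in RHS](cat_take_drop q.+1 s) last_cat;
  case: (drop _ _) (size_drop q.+1 s) => //=; lia.
Qed.

Lemma magnitude_simplex_mid l a b s p q : magnitude_simplex l a b s ->
  (1 <= q < size s - 1)%N -> (1 <= p < (size s).-1 - 1)%N ->
  magnitude_simplex l a b (delete p (delete q s)) ->
  magnitude_simplex l a b (delete q s).
Proof.
case: s => // x s /and4P[xa sb sp /eqP sl].
case: q p => [//|q] [//|p]; rewrite subn1 /= => qs _.
rewrite -[delete q.+1 _]/(x :: delete q s).
rewrite -[delete p.+1 _]/(x :: delete p (delete q s)).
move=> /and4P[_ _ _ /eqP pl].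
have ql : total_dist (x :: delete q s) = l.
  apply/eqP; rewrite eq_le -{1}sl -{1}pl !total_dist_subseq_cons//.
    exact: delete_subseq.
  exact: delete_subseq.
rewrite /magnitude_simplex xa last_delete; last by lia.
by rewrite sb ql eqxx path_delete// ql sl.
Qed.

Definition magnitude_chains (l : R) (a b : X) : chain_complex :=
  alt_complex (m := 1) (@magnitude_simplex_mid l a b).

Definition magnitude_homology (l : R) (a b : X) (k : int) : zmodType :=
  homology (magnitude_chains l a b) k.

End TotalDistance.

Definition causal_space (R : realType) (X : metricType R) : Type :=
  (X * R)%type.

Fact causal_display : Order.disp_t. Proof. exact: Order.Disp tt tt. Qed.

Section CausalOrder.
Variables (R : realType) (X : metricType R).
Local Notation P := (causal_space X).

HB.instance Definition _ := Choice.copy P (X * R)%type.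

Definition causal_le (p q : P) : bool := mdist p.1 q.1 <= q.2 - p.2.

Lemma causal_le_refl : reflexive causal_le.
Proof. by move=> p; rewrite /causal_le mdistxx subrr. Qed.

Lemma causal_le_anti : antisymmetric causal_le.
Proof.
move=> [x t] [y u]; rewrite /causal_le/= metric_sym => /andP[tu ut].
have tuE : t = u.
  apply/le_anti; rewrite -(subr_ge0 t u) -(subr_ge0 u t).
  by rewrite (le_trans _ tu) ?(le_trans _ ut) ?mdist_ge0.
have : mdist y x <= 0 by rewrite (le_trans tu)// tuE subrr.
rewrite le_eqVlt ltNge mdist_ge0 orbF => /eqP/mdist_positivity ->.
by rewrite tuE.
Qed.

Lemma causal_le_trans : transitive causal_le.
Proof.
move=> q p r pq qr; apply: (le_trans (metric_triangle _ q.1 _)).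
by rewrite (le_trans (lerD pq qr))// addrC addrA subrK.
Qed.

HB.instance Definition _ := Order.Le_isPOrder.Build causal_display P
  causal_le_refl causal_le_anti causal_le_trans.

End CausalOrder.

Section CausalComplexes.
Variables (R : realType) (X : metricType R) (l : R) (a b : X).
Local Notation P := (causal_space X).

Definition Cau : set P :=
  [set p | [/\ 0 <= p.2 <= l, mdist a p.1 <= p.2 & mdist p.1 b <= l - p.2]].

(* The points of [X] underlying a finite chain, listed in causal order. *)
Definition chain_points (s : {fset P}) : seq X :=
  [seq p.1 | p : P <- sort <=%O (s : seq P)].

Lemma chain_points_subseq A (s t : {fset P}) : (t `<=` s)%fset ->
  simplices (order_complex A) s -> subseq (chain_points t) (chain_points s).
Proof.
move=> /fsubsetP ts [_ sc].
have st : {in s &, total (<=%O : rel P)} by move=> p q ps qs; exact: sc.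
have tr : {in s & &, transitive (<=%O : rel P)}.
  by move=> ? ? ? _ _ _; exact: le_trans.
rewrite map_subseq//.
suff -> : sort <=%O (t : seq P) = [seq p <- sort <=%O (s : seq P) | p \in t].
  exact: filter_subseq.
have ss : all [in s] s by apply/seq.allP.
rewrite (filter_sort_in st tr (fun p => p \in t) ss).
apply/perm_sort_inP.
- by move=> p q /ts ps /ts qs; exact: st.
- by move=> ? ? ? _ _ _; exact: le_trans.
- by move=> ? ? _ _; exact: le_anti.
apply: uniq_perm; [exact: fset_uniq | by rewrite filter_uniq ?fset_uniq|].
by move=> p; rewrite mem_filter; case: (boolP (p \in t)) => //= /ts ->.
Qed.



Definition short_simplices (A : set P) : set {fset P} :=
  [set s | simplices (order_complex A) s /\ total_dist (chain_points s) < l].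

Lemma short_closed (A : set P) (s t : {fset P}) : (t `<=` s)%fset ->
  short_simplices A s -> short_simplices A t.
Proof.
move=> ts [As sl]; split; first exact: face_closed ts As.
rewrite (le_lt_trans _ sl)// total_dist_subseq//.
exact: chain_points_subseq ts As.
Qed.

(* Delta' Cau *)
Definition short_Cau_complex : complex P := Complex (@short_closed Cau).

Definition light_like (c : seq P) : Prop :=
  [/\ forall p, p \in c -> Cau p, sorted <%O c &
      if c is p :: c' then
        [&& p.2 == 0, (last p c').2 == l &
            path (fun q r : P => mdist q.1 r.1 == r.2 - q.2) p c']
      else false].

Definition Cau_ess : set P := [set p | exists2 c, light_like c & p \in c].

Lemma Cau_ess_sub :
  simplices (inter_complex (order_complex Cau_ess) short_Cau_complex) `<=`
  simplices (order_complex Cau_ess).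
Proof. by move=> s []. Qed.

(* (Delta Cau_ess, Delta' Cau_ess) *)
Definition Cau_ess_pair : complex_pair P := ComplexPair Cau_ess_sub.

Definition calK : set P := Cau_ess `\` [set (a, 0); (b, l)].

Definition K_simplices : set {fset P} :=
  [set s | mdist a b <= l /\ simplices (order_complex calK) s].

Lemma K_closed (s t : {fset P}) :
  (t `<=` s)%fset -> K_simplices s -> K_simplices t.
Proof. by move=> ts [ab Ks]; split=> //; exact: face_closed ts Ks. Qed.

Definition K_complex : complex P := Complex K_closed.

(* By the triangle inequality this is void when [l <= mdist a b]. *)
Definition K'_simplices : set {fset P} :=
  [set s | simplices K_complex s /\
             total_dist (a :: rcons (chain_points s) b) < l].

Lemma K'_closed (s t : {fset P}) :
  (t `<=` s)%fset -> K'_simplices s -> K'_simplices t.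
Proof.
move=> ts [Ks sl]; split; first exact: face_closed ts Ks.
rewrite (le_lt_trans _ sl)// total_dist_subseq_cons// -!cats1 cat_subseq//.
by case: Ks => _; exact: chain_points_subseq ts.
Qed.

Definition K'_complex : complex P := Complex K'_closed.

Lemma K'_sub_K : simplices K'_complex `<=` simplices K_complex.
Proof. by move=> s []. Qed.

Definition K_pair : complex_pair P := ComplexPair K'_sub_K.

End CausalComplexes.

(* Main.v *)
(* When Cau_ess is nonempty it contains A = (a, 0) and B = (b, l), which lie
   below and above all its other points, so Delta Cau_ess is the double cone
   on K with apexes A and B. A chain missing A or B spans a time interval
   shorter than l, hence is automatically short, while a chain through both is
   short exactly when its trace on K lies in K'. These are the simplices of the
   subcomplex of the double suspension: the pairs are simplicially isomorphic.

   A simplex of K outside K' is a chain whose completion by A and B is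
   light-like, so its times are the partial sums of the distances. Adding a and
   b therefore matches the generators of the relative chains in degree k - 2
   with those of the magnitude chains in degree k, and anticommutes with the
   differentials. *)
From HB Require Import structures.
Require Import Defs.
From mathcomp Require Import all_boot all_order all_algebra.
From mathcomp Require Import finmap zify freeg.
From mathcomp Require Import all_classical all_reals all_analysis.
Import Order.TTheory GRing.Theory Num.Theory.
Import numFieldNormedType.Exports.
Local Open Scope classical_set_scope.
Local Open Scope ring_scope.

Set Implicit Arguments.
Unset Strict Implicit.
Unset Printing Implicit Defensive.

(** * Realizations and suspensions of pairs *)

Section RealizationMap.
Variables (R : realType).

Lemma realization_eq (V : choiceType) (S : complex V) (x y : realization R S) :
  bary x =1 bary y -> x = y.
Proof.
case: x y => [f Hf] [g Hg] /= /funext fg; case: _ / fg Hg => Hg.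
by congr Realization; exact: Prop_irrelevance.
Qed.

Variables (V W : choiceType) (S : complex V) (T : complex W).
Variables (phi : V -> W) (psi : W -> V).
Hypothesis phiK : forall s v, simplices S s -> v \in s -> psi (phi v) = v.
Hypothesis phiS : forall s, simplices S s -> simplices T (phi @` s)%fset.

(** Pushforward of barycentric coordinates. As [phi] is injective on the vertices that carry weight,
    the fibre over [w] contributes at most the single term at [psi w], and the test discards [w]
    when [psi w] is not a preimage of it. *)
Definition push_bary (f : V -> R) (w : W) : R :=
  if phi (psi w) == w then f (psi w) else 0.

Lemma push_bary_out (s : {fset V}) (f : V -> R) w :
  (forall v, v \notin s -> f v = 0) ->
  w \notin (phi @` s)%fset -> push_bary f w = 0.
Proof.
move=> f0 ws; rewrite /push_bary; case: eqP => // pw; apply: f0.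
by apply: contra ws => ws; apply/imfsetP; exists (psi w).
Qed.

Lemma push_bary_subproof (x : realization R S) :
  exists2 t : {fset W}, simplices T t &
    [/\ forall w, 0 <= push_bary (bary x) w,
        forall w, w \notin t -> push_bary (bary x) w = 0 &
        \sum_(w <- t) push_bary (bary x) w = 1].
Proof.
case: x => f [s Ss [f0 fs f1]] /=; exists (phi @` s)%fset; first exact: phiS.
split=> [w|w|]; first by rewrite /push_bary; case: ifP.
  exact: push_bary_out.
rewrite big_imfset/=; last first.
  by move=> u v us vs uv; rewrite -(phiK Ss us) uv (phiK Ss vs).
rewrite -f1 big_seq [RHS]big_seq; apply: eq_bigr => v vs.
by rewrite /push_bary (phiK Ss vs) eqxx.
Qed.

Definition realization_map (x : realization R S) : realization R T :=
  Realization (push_bary_subproof x).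

Lemma cell_realization_map s (x : realization R S) :
  cell s x -> cell (phi @` s)%fset (realization_map x).
Proof. by move=> sx w; exact: push_bary_out. Qed.

(** In the weak topology openness is checked on one closed simplex at a time; there the map only
    relabels coordinates, so the same radius works. *)
Lemma realization_map_continuous : continuous realization_map.
Proof.
apply/continuousP => U oU.
suff: realization_open (realization_map @^-1` U) by [].
have {}oU : realization_open U by exact: oU.
move=> s Ss x Ux sx.
have [e e0 eU] := oU _ (phiS Ss) _ Ux (cell_realization_map sx).
exists e => // y sy xy; apply: eU; first exact: cell_realization_map.
move=> w /imfsetP[v /= vs ->].
by rewrite /= /push_bary (phiK Ss vs) eqxx; exact: xy.
Qed.

End RealizationMap.

Lemma pair_homotopic_eq (R : realType) (P Q : space_pair) (f g : P -> Q) :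
  pair_map f -> f =1 g -> pair_homotopic R f g.
Proof.
move=> [cf fsub] fg; exists (fun x => f x.1); split => //=.
  apply: continuous_subspaceT => x.
  apply: continuous_comp; first exact: cvg_fst.
  exact: cf.
by move=> x t Px _; apply: fsub; exists x.
Qed.

(** * Simplicially isomorphic pairs *)

Section IsomorphicPairs.
Variables (R : realType) (V W : choiceType).
Variables (K : complex_pair V) (L : complex_pair W).
Variables (phi : V -> W) (psi : W -> V).
Hypothesis phiK : cancel phi psi.
Hypothesis psiK :
  forall t w, simplices (pair_total L) t -> w \in t -> phi (psi w) = w.
Hypothesis totalE : forall s,
  simplices (pair_total K) s <-> simplices (pair_total L) (phi @` s)%fset.
Hypothesis subE : forall s,
  simplices (pair_sub K) s <-> simplices (pair_sub L) (phi @` s)%fset.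

Let imfset_psiK t : simplices (pair_total L) t ->
  (phi @` (psi @` t) = t)%fset.
Proof.
move=> Lt; apply/fsetP => w; apply/imfsetP/idP.
  move=> [v /= /imfsetP[u /= ut ->] ->].
  by rewrite (psiK Lt ut).
by move=> wt; exists (psi w); rewrite ?(psiK Lt wt)//=; apply/imfsetP; exists w.
Qed.

Let phi_total s :
  simplices (pair_total K) s -> simplices (pair_total L) (phi @` s)%fset.
Proof. by move/totalE. Qed.

Let psi_total t :
  simplices (pair_total L) t -> simplices (pair_total K) (psi @` t)%fset.
Proof. by move=> Lt; apply/totalE; rewrite imfset_psiK. Qed.

(** The two realization maps are mutually inverse, so constant homotopies suffice. [psiK] is asked
    only on vertices of simplices because the vertex type of a suspension also contains elements
    outside the complex. *)
Lemma isomorphic_pair_homotopy_equivalent : pair_homotopy_equivalent R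
  (realization_pair R K) (realization_pair R L).
Proof.
pose f : realization_pair R K -> realization_pair R L :=
  realization_map (fun s v _ _ => phiK v) phi_total.
pose g : realization_pair R L -> realization_pair R K :=
  realization_map psiK psi_total.
have fP : pair_map f.
  split; first exact: realization_map_continuous.
  move=> _ [x [s Ks sx] <-]; exists (phi @` s)%fset; first exact/subE.
  exact: cell_realization_map.
have gP : pair_map g.
  split; first exact: realization_map_continuous.
  move=> _ [x [s Ks sx] <-]; exists (psi @` s)%fset.
    by apply/subE; rewrite imfset_psiK//; exact: pair_sub_total Ks.
  exact: cell_realization_map.
have pcomp (P Q T : space_pair) (u : P -> Q) (v : Q -> T) :
    pair_map u -> pair_map v -> pair_map (v \o u).
  move=> [cu Pu] [cv Pv]; split.
    by move=> x; apply: continuous_comp; [exact: cu|exact: cv].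
  by move=> _ [x Px <-]; apply: Pv; exists (u x) => //; apply: Pu; exists x.
exists f, g; split=> //; apply: pair_homotopic_eq; try exact: pcomp.
  move=> x; apply: realization_eq => v /=.
  by rewrite /push_bary /= /push_bary !phiK !eqxx.
move=> y; apply: realization_eq => w /=.
rewrite /push_bary /= /push_bary; case: eqP => [->|]; first by rewrite eqxx.
(* A [w] with [phi (psi w) <> w] lies in no simplex, so its coordinate is 0. *)
case: y => h [t Lt [_ ht _]] /= pw; rewrite ht//; apply/negP => /(psiK Lt).
exact: pw.
Qed.

End IsomorphicPairs.

(** Collapsing the whole space leaves only the base point [None], so both quotients are one-point
    spaces. *)
Lemma pointed_quotient_setT (R : realType) (P Q : space_pair) :
  @subspace_of P = setT -> @subspace_of Q = setT ->
  pair_homotopy_equivalent R (pointed_quotient P) (pointed_quotient Q).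
Proof.
have collapseT (P' : space_pair) : @subspace_of P' = setT ->
    forall x : pointed_quotient P', x = None.
  by move=> PT [[x xP]|//]; exfalso; move: xP; rewrite PT in_setT.
have cst_map (P' Q' : space_pair) :
    pair_map (fun _ : pointed_quotient P' => None : pointed_quotient Q').
  by split=> [|_ [x _ <-]]; [exact: cst_continuous|].
move=> /collapseT PT /collapseT QT; exists (fun=> None), (fun=> None).
by split=> //; apply: pair_homotopic_eq => // x /=; rewrite ?PT// QT.
Qed.

Lemma subspace_realization_pair (R : realType) (V : choiceType)
    (K : complex_pair V) :
  simplices (pair_total K) `<=` simplices (pair_sub K) ->
  @subspace_of (realization_pair R K) = setT.
Proof.
move=> KK; apply/seteqP; split=> // x _.
by case: x => f [s Ks [f0 fs f1]]; exists s => //; exact: KK.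
Qed.

(** * Simplices of a suspension, read off from their trace on the base *)

Section SuspensionSimplices.
Variable V : choiceType.
Implicit Types (u : {fset option V}) (S : complex V) (K : complex_pair V).

(** The trace on the base: the apex [None] is dropped. Through it, membership in cones and
    suspensions becomes a condition without existential quantifier. *)
Definition unbase u : {fset V} := [fset v in pmap id u]%fset.

Lemma in_unbase u v : (v \in unbase u) = (Some v \in u).
Proof. by rewrite !inE mem_pmap map_id. Qed.

Lemma in_base (s : {fset V}) v : (Some v \in base s) = (v \in s).
Proof. by rewrite mem_imfset//; exact: Some_inj. Qed.

Lemma None_base (s : {fset V}) : (None \in base s) = false.
Proof. by apply/negP => /imfsetP[]. Qed.

Lemma base_unbase u : None \notin u -> base (unbase u) = u.
Proof.
move=> uN; apply/fsetP => -[v|]; first by rewrite in_base in_unbase.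
by rewrite None_base (negbTE uN).
Qed.

Lemma cone_simplicesP S u :
  simplices (cone S) u <-> simplices S (unbase u).
Proof.
split=> [[s Ss us]|Su].
  rewrite (_ : unbase u = s)//; apply/fsetP => v; rewrite in_unbase.
  by case: us => ->; rewrite ?inE in_base.
exists (unbase u) => //; case: (boolP (None \in u)) => uN; [right|left].
  apply/fsetP => -[v|]; first by rewrite !inE in_base in_unbase.
  by rewrite !inE uN.
by rewrite base_unbase.
Qed.

Lemma embed_simplicesP S u :
  simplices (embed S) u <-> None \notin u /\ simplices S (unbase u).
Proof.
split=> [[s Ss ->]|[uN Su]]; last by exists (unbase u); rewrite ?base_unbase.
rewrite None_base; split=> //; rewrite (_ : unbase _ = s)//.
by apply/fsetP => v; rewrite in_unbase in_base.
Qed.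

Lemma suspension_simplicesP K u :
  simplices (pair_sub (suspension K)) u <->
  simplices (pair_sub K) (unbase u) \/
    None \notin u /\ simplices (pair_total K) (unbase u).
Proof.
by split=> -[/cone_simplicesP|/embed_simplicesP]; [left|right|left|right].
Qed.

Lemma suspension_full K :
  simplices (pair_total K) `<=` simplices (pair_sub K) ->
  simplices (pair_total (suspension K)) `<=`
  simplices (pair_sub (suspension K)).
Proof.
by move=> KK u /cone_simplicesP/KK Ku; apply/suspension_simplicesP; left.
Qed.

End SuspensionSimplices.

(** * Causal chains and the double suspension *)

Section SortedChains.
Variables (d : Order.disp_t) (P : porderType d).

Lemma lt_sorted_comparable (s : seq P) :
  sorted <%O s -> {in s &, forall x y, (x >=< y)%O}.
Proof.
elim: s => [|z s IH]// zs x y; rewrite !inE.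
have /allP zmin := order_path_min lt_trans zs.
move=> /orP[/eqP->|xs] /orP[/eqP->|ys]; first exact: comparablexx.
- exact/lt_comparable/zmin.
- exact/gt_comparable/zmin.
- exact: IH (path_sorted zs) _ _ xs ys.
Qed.

(** The order is only partial, but [sort] needs totality only among the entries sorted, and those
    form a chain. *)
Lemma sorted_sort_simplex (A : set P) (s : {fset P}) :
  simplices (order_complex A) s -> sorted <%O (sort <=%O s).
Proof.
move=> [_ sc]; rewrite lt_sorted_uniq_le sort_uniq fset_uniq/=.
apply: (sort_sorted_in (P := mem s)); last exact/allP.
by move=> x y xs ys; exact: sc.
Qed.

Lemma sort_vertices (s : seq P) : sorted <%O s -> sort <=%O (vertices s) = s.
Proof.
move=> ss; apply: lt_sorted_eq => //; last first.
  by move=> x; rewrite mem_sort in_vertices.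
apply: (@sorted_sort_simplex setT); split=> // x y.
rewrite !in_vertices; exact: lt_sorted_comparable.
Qed.

End SortedChains.

(** * Length against elapsed time along causal chains *)

Section CausalChains.
Variables (R : realType) (X : metricType R).
Local Notation P := (causal_space X).

Definition light (q r : P) : bool := mdist q.1 r.1 == r.2 - q.2.

(** Each causal step covers at most its elapsed time, and elapsed times telescope. Equality of the
    sums forces equality in every step, which [leifD] keeps track of. *)
Lemma total_dist_causal (p : P) (s : seq P) : path <=%O p s ->
  total_dist [seq q.1 | q : P <- p :: s] <= (last p s).2 - p.2
    ?= iff path light p s.
Proof.
elim: s p => [|q s IH] p.
  by move=> _; rewrite total_dist1 subrr; exact/leif_refl.
move=> /andP[pq qs]; rewrite [path _ _ _]/=.
rewrite total_dist_cons2.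
rewrite (_ : _ - p.2 = (q.2 - p.2) + ((last q s).2 - q.2)); last first.
  by rewrite [RHS]addrC addrA subrK.
by apply: leifD (IH _ qs); exact: leif_eq.
Qed.

Lemma chain_points_vertices (s : seq P) : sorted <%O s ->
  chain_points (vertices s) = [seq q.1 | q : P <- s].
Proof. by move=> ss; rewrite /chain_points sort_vertices. Qed.

Variables (l : R) (a b : X).
Hypothesis l_gt0 : 0 < l.
Local Notation A := ((a, 0) : P).
Local Notation B := ((b, l) : P).

Lemma Cau_geA p : Cau l a b p -> (A <= p)%O.
Proof. by case=> _ + _; rewrite -[p.2]subr0. Qed.

Lemma Cau_leB p : Cau l a b p -> (p <= B)%O.
Proof. by case. Qed.

Lemma Cau_fst0 p : Cau l a b p -> p.2 <= 0 -> p = A.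
Proof.
move=> Cp p0; apply/eqP; rewrite eq_le Cau_geA// andbT.
case: Cp => /andP[p0' _] ap _.
have p2 : p.2 = 0 by apply/le_anti; rewrite p0.
by rewrite /Order.le /= /causal_le /= p2 subrr metric_sym -p2.
Qed.

Lemma Cau_sndl p : Cau l a b p -> l <= p.2 -> p = B.
Proof.
move=> Cp p0; apply/eqP; rewrite eq_le Cau_leB//=.
case: Cp => /andP[_ p0'] _ ap.
have p2 : p.2 = l by apply/le_anti; rewrite p0 p0'.
by rewrite /Order.le /= /causal_le /= p2 subrr metric_sym -[0](subrr l) -{2}p2.
Qed.

Lemma Cau_essW p : Cau_ess l a b p -> Cau l a b p.
Proof. by case=> c [cC _ _] /cC. Qed.

(** A light-like chain starts at time 0 and ends at time [l], where [A] and [B] are the only points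
    of [Cau]; so any such chain contains both. *)
Lemma Cau_ess_ends : Cau_ess l a b !=set0 -> Cau_ess l a b A /\ Cau_ess l a b B.
Proof.
case=> p [c cl _]; case: (cl); case: c cl => [|q c] cl cC cs //.
move=> /and3P[/eqP q0 /eqP ql _].
have <- : q = A by apply: Cau_fst0; rewrite ?q0//; apply: cC; rewrite mem_head.
have <- : last q c = B.
  by apply: Cau_sndl; rewrite ?ql//; apply: cC; rewrite mem_last.
by split; exists (q :: c); rewrite ?mem_head ?mem_last.
Qed.

Lemma calK_between p : calK l a b p -> (A < p)%O /\ (p < B)%O.
Proof.
move=> [/Cau_essW Cp pAB]; rewrite !lt_neqAle Cau_geA// Cau_leB// !andbT.
split; apply/eqP => pE; apply: pAB; [left|right]; first exact/esym.
exact: pE.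
Qed.

Lemma AB_lt : mdist a b <= l -> (A < B)%O.
Proof.
move=> ab; rewrite lt_neqAle xpair_eqE negb_and lt_eqF// orbT /=.
by rewrite /Order.le /= /causal_le /= subr0.
Qed.

Lemma path_calK (s : seq P) : mdist a b <= l ->
  sorted <%O s -> (forall p, p \in s -> calK l a b p) ->
  path <%O A (rcons s B).
Proof.
move=> /AB_lt AB ss sK; rewrite rcons_path.
case: s ss sK => [|p s]; first by rewrite /= AB.
rewrite /= => -> sK; rewrite (calK_between (sK p _)).1 ?mem_head//=.
by rewrite (calK_between (sK _ (mem_last _ _))).2.
Qed.

End CausalChains.

(** * The simplicial isomorphism with the double suspension *)

Section SuspensionIso.
Variables (R : realType) (X : metricType R) (l : R) (a b : X).
Hypotheses (l_gt0 : 0 < l) (dab_le_l : mdist a b <= l).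
Local Notation P := (causal_space X).
Local Notation A := ((a, 0) : P).
Local Notation B := ((b, l) : P).

(** The length is at most the time between the first and the last point. Without [A] the first time
    is positive; without [B] the last one is below [l]. *)
Lemma short_missing_end (s : {fset P}) :
  simplices (order_complex (Cau l a b)) s -> A \notin s \/ B \notin s ->
  total_dist (chain_points s) < l.
Proof.
move=> sC AB; have := sorted_sort_simplex sC.
have cC p : p \in sort <=%O s -> Cau l a b p by rewrite mem_sort => /sC.1.
have memc p : p \in sort <=%O s -> p \in s by rewrite mem_sort.
rewrite /chain_points; case: (sort _ _) cC memc => [|p c] cC memc pc.
  (* The empty chain has length 0, which is below [l]. *)
  by rewrite /total_dist.
have pc' : path <=%O p c by apply: sub_path pc => ? ?; exact: ltW.
apply: (le_lt_trans (total_dist_causal pc')).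
have Cp := cC _ (mem_head p c); have Cq := cC _ (mem_last p c).
have p_ge0 : 0 <= p.2 by case: Cp => /andP[].
have q_lel : (last p c).2 <= l by case: Cq => /andP[].
case: AB => AB.
  rewrite (lt_le_trans _ q_lel)// ltrBlDr ltrDl ltNge.
  by apply: contra AB => /(Cau_fst0 Cp) <-; rewrite memc// mem_head.
rewrite (le_lt_trans _ (y := (last p c).2))// ?gerBl// ltNge.
by apply: contra AB => /(Cau_sndl Cq) <-; rewrite memc// mem_last.
Qed.

(** [A] becomes the apex of the outer suspension and [B] that of the inner one. *)
Definition susp_vertex (p : P) : option (option P) :=
  if p == A then None else if p == B then Some None else Some (Some p).

Definition susp_point (w : option (option P)) : P :=
  match w with None => A | Some None => B | Some (Some p) => p end.

Lemma susp_vertexK : cancel susp_vertex susp_point.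
Proof. by move=> p; rewrite /susp_vertex; case: eqP => //; case: eqP. Qed.

Lemma susp_pointK w : w != Some (Some A) -> w != Some (Some B) ->
  susp_vertex (susp_point w) = w.
Proof.
case: w => [[p|]|]//=; rewrite /susp_vertex.
- move=> pA pB; case: eqP => [pE|_]; first by rewrite pE eqxx in pA.
  by case: eqP => [pE|//]; rewrite pE eqxx in pB.
- by rewrite eq_sym (lt_eqF (AB_lt _ _)) ?eqxx.
- by rewrite eqxx.
Qed.

(** The trace of [s] on K, that is [s] without [A] and [B], in the form produced by unfolding the
    double suspension. *)
Let inner (s : {fset P}) := unbase (unbase (susp_vertex @` s)%fset).

Let BA : (B == A) = false.
Proof. by rewrite eq_sym (lt_eqF (AB_lt _ _)). Qed.

Let in_inner (s : {fset P}) p : (p \in inner s) = [&& p != A, p != B & p \in s].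
Proof.
rewrite !in_unbase; apply/imfsetP/and3P => [[q /= qs]|[pA pB ps]].
  rewrite /susp_vertex; case: eqP => // /eqP qA; case: eqP => // /eqP qB [->].
  by split.
by exists p => //; rewrite /susp_vertex (negbTE pA) (negbTE pB).
Qed.

Let None_susp (s : {fset P}) : (None \in (susp_vertex @` s)%fset) = (A \in s).
Proof.
rewrite -[None](_ : susp_vertex A = _); last by rewrite /susp_vertex eqxx.
by rewrite mem_imfset//; exact: can_inj susp_vertexK.
Qed.

Let SomeNone_susp (s : {fset P}) :
  (None \in unbase (susp_vertex @` s)%fset) = (B \in s).
Proof.
rewrite in_unbase -[Some None](_ : susp_vertex B = _); last first.
  by rewrite /susp_vertex BA eqxx.
by rewrite mem_imfset//; exact: can_inj susp_vertexK.
Qed.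

Hypothesis ess : Cau_ess l a b !=set0.

(** [A] and [B] belong to [Cau_ess] and are comparable with all its points, so putting them back
    into a chain keeps it a chain. *)
Let inner_total (s : {fset P}) : simplices (order_complex (Cau_ess l a b)) s <->
  K_simplices l a b (inner s).
Proof.
have [essA essB] := Cau_ess_ends ess.
split=> [[sC sc]|[_ [sK sc]]].
  split=> //; split=> [p|p q].
    rewrite in_inner => /and3P[/eqP pA /eqP pB /sC ?].
    by split=> // -[].
  rewrite !in_inner => /and3P[_ _ ps] /and3P[_ _ qs]; exact: sc.
have sC p : p \in s -> Cau_ess l a b p.
  move=> ps; have [->//|pA] := eqVneq p A; have [->//|pB] := eqVneq p B.
  by apply: (sK p _).1; rewrite in_inner pA pB.
split=> // p q ps qs.
have [Cp Cq] := (Cau_essW (sC _ ps), Cau_essW (sC _ qs)).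
have [->|pA] := eqVneq p A; first exact: le_comparable (Cau_geA Cq).
have [->|pB] := eqVneq p B; first exact: ge_comparable (Cau_leB Cq).
have [->|qA] := eqVneq q A; first exact: ge_comparable (Cau_geA Cp).
have [->|qB] := eqVneq q B; first exact: le_comparable (Cau_leB Cp).
by apply: sc; rewrite in_inner ?pA ?pB ?qA ?qB.
Qed.

Let inner_points (s : {fset P}) : simplices (order_complex (Cau_ess l a b)) s ->
  A \in s -> B \in s ->
  chain_points s = a :: rcons (chain_points (inner s)) b.
Proof.
move=> /inner_total[_ Ks] As Bs; have ss := sorted_sort_simplex Ks.
have pAB : path <%O A (rcons (sort <=%O (inner s)) B).
  by apply: path_calK => // p; rewrite mem_sort => /Ks.1.
have sE : vertices (A :: rcons (sort <=%O (inner s)) B) = s.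
  apply/fsetP => p; rewrite in_vertices inE mem_rcons inE mem_sort in_inner.
  by have [->//|_] := eqVneq p A; have [->//|_] := eqVneq p B.
by rewrite -[in LHS]sE chain_points_vertices//= map_rcons.
Qed.

(** If [A] is missing, [s] lies in the base of the outer suspension; if only [B] is missing, over
    the base of the inner one. Such chains are short anyway. With both ends present, being short is
    the condition defining K'. *)
Let inner_sub (s : {fset P}) : simplices (pair_sub (Cau_ess_pair l a b)) s <->
  simplices (pair_sub (suspension (suspension (K_pair l a b))))
    (susp_vertex @` s)%fset.
Proof.
have CauW : simplices (order_complex (Cau_ess l a b)) s ->
    simplices (order_complex (Cau l a b)) s.
  by move=> [sC sc]; split=> // p /sC/Cau_essW.
rewrite suspension_simplicesP suspension_simplicesP None_susp SomeNone_susp.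
rewrite [pair_total (suspension _)]/= cone_simplicesP -/(inner s).
split=> [[Ks [_ sl]]|Ks].
  have [As|As] := boolP (A \in s); last by right; split=> //; exact/inner_total.
  left; have [Bs|Bs] := boolP (B \in s); last first.
    by right; split=> //; exact/inner_total.
  left; split; first exact/inner_total.
  by rewrite -inner_points.
have Ts : simplices (order_complex (Cau_ess l a b)) s.
  by apply/inner_total; case: Ks => [[[]|[]]|[]].
split=> //; split; first exact: CauW.
have [As|As] := boolP (A \in s); last first.
  by apply: short_missing_end; [exact: CauW | left].
have [Bs|Bs] := boolP (B \in s); last first.
  by apply: short_missing_end; [exact: CauW | right].
rewrite inner_points//.
by move: Ks; rewrite As Bs => -[[[]|[]]|[]].
Qed.

Lemma Cau_ess_pair_suspension : pair_homotopy_equivalent R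
  (realization_pair R (Cau_ess_pair l a b))
  (realization_pair R (suspension (suspension (K_pair l a b)))).
Proof.
apply: (@isomorphic_pair_homotopy_equivalent _ _ _ _ _ _ susp_point).
- exact: susp_vertexK.
- move=> t w /cone_simplicesP/cone_simplicesP[_ [tK _]] wt.
  by apply: susp_pointK; apply/eqP => wE; move: wt; rewrite wE;
    rewrite -!in_unbase => /tK[_ []]; [left|right].
- move=> s; rewrite [pair_total (suspension _)]/= !cone_simplicesP.
  exact: inner_total.
- exact: inner_sub.
Qed.

End SuspensionIso.

(** * The case of empty [Cau_ess] *)

Section Degenerate.
Variables (R : realType) (X : metricType R) (l : R) (a b : X).
Hypotheses (l_gt0 : 0 < l) (dab_le_l : mdist a b <= l).
Hypothesis ess0 : Cau_ess l a b = set0.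
Local Notation P := (causal_space X).

Let fset0P (s : {fset P}) : (forall p, p \in s -> Cau_ess l a b p) -> s = fset0.
Proof.
move=> sC; apply/eqP; have [->|[p /sC]] := fset_0Vmem s; first exact: eqxx.
by rewrite ess0.
Qed.

Let points0 : chain_points (fset0 : {fset P}) = [::].
Proof.
rewrite /chain_points (_ : sort _ _ = [::])//.
Qed.

(** The two-point chain from [A] to [B] is then light-like. Contrapositively, an empty [Cau_ess]
    gives the strict bound that puts the empty simplex into K'. *)
Lemma Cau_ess_nonempty_light : mdist a b = l -> Cau_ess l a b !=set0.
Proof.
move=> ab; exists (a, 0); exists [:: (a, 0); (b, l)]; last exact: mem_head.
split=> [p||].
- rewrite !inE => /orP[]/eqP -> /=; split=> /=.
  + by rewrite lexx ltW.
  + by rewrite mdistxx.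
  + by rewrite subr0.
  + by rewrite lexx ltW.
  + by [].
  + by rewrite mdistxx subrr.
- by rewrite /= andbT (AB_lt l_gt0).
- by rewrite /= !eqxx subr0 ab eqxx.
Qed.

(** The empty simplex is the only one in [Cau_ess] and in K, and it lies in both subcomplexes. So
    each pair has equal terms, suspension preserves this, and both quotients are trivial. *)
Lemma degenerate_quotients : pair_homotopy_equivalent R
  (pointed_quotient (realization_pair R (Cau_ess_pair l a b)))
  (pointed_quotient
     (realization_pair R (suspension (suspension (K_pair l a b))))).
Proof.
apply: pointed_quotient_setT; apply: subspace_realization_pair.
  move=> s Cs; split=> //; have -> : s = fset0 by apply: fset0P; exact: Cs.1.
  by split; [split=> p; rewrite inE | rewrite points0 /total_dist].
do 2 apply: suspension_full; move=> s Ks; split=> //.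
have -> : s = fset0 by apply: fset0P => p /(Ks.2.1) [].
rewrite points0 total_dist_cons2 total_dist1 addr0 lt_neqAle dab_le_l andbT.
by apply/eqP => /Cau_ess_nonempty_light; rewrite ess0 => -[].
Qed.

End Degenerate.

(** * Maps induced in homology *)

Section QuotientLift.
Local Open Scope quotient_scope.
Variables (U V : zmodType) (I : zmodClosed U) (h : {additive U -> V}).
Local Notation Q := (ring_quotient.Quotient.quot I).

(* The proof that [h] vanishes on [I] is an argument so that the additive
   structure below can be inferred. *)
Definition quot_lift of (forall x, x \in I -> h x = 0) : Q -> V :=
  fun q => h (repr q).

Hypothesis hI : forall x, x \in I -> h x = 0.

Lemma quot_lift_pi x : quot_lift hI (\pi_Q x) = h x.
Proof.
apply/eqP; rewrite -subr_eq0 -raddfB; apply/eqP/hI.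
by rewrite ring_quotient.Quotient.idealrBE reprK.
Qed.

Lemma quot_lift_zmod : zmod_morphism (quot_lift hI).
Proof.
move=> x y; rewrite -[x]reprK -[y]reprK -raddfB !quot_lift_pi.
exact: raddfB.
Qed.
HB.instance Definition _ := GRing.isZmodMorphism.Build Q V (quot_lift hI)
  quot_lift_zmod.

End QuotientLift.

Lemma homology_class_surj (C : chain_complex) n (q : homology C n) :
  exists x, q = (\pi_(homology C n) x)%qT.
Proof. by exists (repr q); rewrite reprK. Qed.

Section HomologyMap.
Local Open Scope quotient_scope.
Variables (C D : chain_complex) (n m : int) (h : {additive C n -> D m}).
Hypothesis h_cycle : forall x, differential C n (n - 1) x = 0 ->
  differential D m (m - 1) (h x) = 0.
Hypothesis h_boundary : forall y, exists z,
  h (differential C (n + 1) n y) = differential D (m + 1) m z.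

Lemma cycle_map_subproof (x : cycle_group C n) : h (val x) \in @cycles D m.
Proof. by apply/eqP/h_cycle/eqP; exact: valP x. Qed.

Definition cycle_map (x : cycle_group C n) : cycle_group D m :=
  exist (fun y => y \in @cycles D m) _ (cycle_map_subproof x).

Definition cycle_class_map (x : cycle_group C n) : homology D m :=
  \pi_(homology D m) (cycle_map x).

Lemma cycle_class_map_zmod : zmod_morphism cycle_class_map.
Proof.
move=> x y; rewrite /cycle_class_map -raddfB; congr (\pi _).
by apply: val_inj; rewrite /= !raddfB.
Qed.
HB.instance Definition _ := GRing.isZmodMorphism.Build
  (cycle_group C n) (homology D m) cycle_class_map cycle_class_map_zmod.

Lemma cycle_class_map_boundary x :
  x \in @boundaries C n -> cycle_class_map x = 0.
Proof.
move=> /asboolP[y yx]; rewrite /cycle_class_map -(raddf0 (\pi_(homology D m))).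
apply/eqP; rewrite -ring_quotient.Quotient.idealrBE subr0.
have [z hz] := h_boundary y; apply/asboolP; exists z.
by rewrite -hz yx.
Qed.

(** Only one degree is involved: [h] has to preserve cycles and boundaries, so maps commuting with
    the differentials up to sign qualify. *)
Definition homology_map : homology C n -> homology D m :=
  quot_lift cycle_class_map_boundary.
HB.instance Definition _ := GRing.Additive.on homology_map.

Lemma homology_map_pi x :
  homology_map (\pi_(homology C n) x) = \pi_(homology D m) (cycle_map x).
Proof. exact: quot_lift_pi. Qed.

End HomologyMap.

(** * Complexes isomorphic up to sign and a degree shift *)

Section IsomorphicComplexes.
Local Open Scope quotient_scope.
Variables (C D : chain_complex) (r : int).
Variables (f : forall i j, {additive C i -> D j}).
Variables (g : forall i j, {additive D j -> C i}).
Hypothesis fK : forall i j, i = j + r -> cancel (f i j) (g i j).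
Hypothesis gK : forall i j, i = j + r -> cancel (g i j) (f i j).
(* Removing both ends of a chain shifts the signs of its faces by one. *)
Hypothesis g_diff : forall i j i' j' y, i = j + r -> i' = j' + r ->
  g i' j' (differential D j j' y) = - differential C i i' (g i j y).

Let f_diff i j i' j' x : i = j + r -> i' = j' + r ->
  f i' j' (differential C i i' x) = - differential D j j' (f i j x).
Proof.
move=> ij ij'; apply: (can_inj (gK ij')); rewrite fK//.
by rewrite raddfN (g_diff _ ij ij') fK// opprK.
Qed.

(** Anticommuting with the differentials preserves kernels and images. Indexing [f] and [g] by both
    degrees lets [lia] supply the neighbouring degree equations without transports. *)
Lemma isomorphic_homology n m : n = m + r ->
  isomorphic_groups (homology C n) (homology D m).
Proof.
move=> nm; have nm1 : n - 1 = m - 1 + r by lia.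
have nm2 : n + 1 = m + 1 + r by lia.
have f_cycle x : differential C n (n - 1) x = 0 ->
    differential D m (m - 1) (f n m x) = 0.
  by move=> x0; rewrite -[LHS]opprK -(f_diff _ nm nm1) x0 raddf0 oppr0.
have g_cycle y : differential D m (m - 1) y = 0 ->
    differential C n (n - 1) (g n m y) = 0.
  by move=> y0; rewrite -[LHS]opprK -(g_diff _ nm nm1) y0 raddf0 oppr0.
have f_boundary x : exists z,
    f n m (differential C (n + 1) n x) = differential D (m + 1) m z.
  (* The sign is absorbed into the chain being bounded. *)
  by exists (- f _ _ x); rewrite raddfN; exact: f_diff.
have g_boundary y : exists z,
    g n m (differential D (m + 1) m y) = differential C (n + 1) n z.
  by exists (- g _ _ y); rewrite raddfN; exact: g_diff.
exists (homology_map f_cycle f_boundary).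
exists (homology_map g_cycle g_boundary).
  move=> q; have [x ->] := homology_class_surj q.
  rewrite /= (homology_map_pi f_cycle) homology_map_pi; congr (\pi _).
  by apply: val_inj => /=; rewrite fK.
move=> q; have [x ->] := homology_class_surj q.
rewrite /= (homology_map_pi g_cycle) homology_map_pi; congr (\pi _).
by apply: val_inj => /=; rewrite gK.
Qed.

End IsomorphicComplexes.

(** * Light-like chains and magnitude chains *)

Section LightChains.
Variables (R : realType) (X : metricType R) (l : R) (a b : X).
Hypotheses (l_gt0 : 0 < l) (dab_le_l : mdist a b <= l).
Local Notation P := (causal_space X).
Local Notation A := ((a, 0) : P).
Local Notation B := ((b, l) : P).
Local Notation K := (K_pair l a b).
Implicit Types (s : seq P) (m : seq X).

(** The only light-like lift of [m] that continues from [(x, t)]: times are [t] plus the partial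
    sums of distances. *)
Fixpoint light_seq (x : X) (t : R) m : seq P :=
  if m is y :: m' then (y, t + mdist x y) :: light_seq y (t + mdist x y) m'
  else [::].

Lemma map_light_seq x t m : [seq q.1 | q : P <- light_seq x t m] = m.
Proof. by elim: m x t => //= y m IH x t; rewrite IH. Qed.

Lemma light_seq_rcons x t m y :
  exists u, light_seq x t (rcons m y) = rcons (light_seq x t m) (y, u).
Proof.
elim: m x t => [|z m IH] x t /=; first by exists (t + mdist x y).
by have [u ->] := IH z (t + mdist x z); exists u.
Qed.

Lemma path_light_seq x t m : path (@light R X) (x, t) (light_seq x t m).
Proof.
elim: m x t => //= y m IH x t; rewrite IH andbT /light /=.
by rewrite addrAC subrr add0r.
Qed.

Lemma light_seqK (p : P) s : path (@light R X) p s ->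
  light_seq p.1 p.2 [seq q.1 | q : P <- s] = s.
Proof.
elim: s p => //= q s IH p /andP[/eqP pq qs].
by rewrite pq addrC subrK -surjective_pairing IH.
Qed.

(** On a light-like step equal points force equal times. Hence strict causal chains correspond to
    tuples with distinct consecutive points. *)
Lemma light_lt (p q : P) : light p q -> (p < q)%O = (p.1 != q.1).
Proof.
move=> /eqP pq; have ple : (p <= q)%O by rewrite /Order.le /= /causal_le pq.
rewrite lt_neqAle ple andbT.
rewrite [p]surjective_pairing [q]surjective_pairing xpair_eqE negb_and /=.
case: (eqVneq p.1 q.1) pq => //= -> /eqP; rewrite mdistxx eq_sym subr_eq0.
by rewrite eq_sym => ->.
Qed.

Lemma path_light_lt (p : P) s : path (@light R X) p s ->
  path <%O p s = path (fun y z : X => y != z) p.1 [seq q.1 | q : P <- s].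
Proof. by elim: s p => //= q s IH p /andP[/light_lt -> /IH ->]. Qed.

Lemma total_dist_light (p : P) s : path <=%O p s ->
  (total_dist [seq q.1 | q : P <- p :: s] == (last p s).2 - p.2) =
  path (@light R X) p s.
Proof. by move=> /total_dist_causal H; rewrite H. Qed.

Definition ends m : seq X := a :: rcons m b.

Local Notation ends_of s := (ends [seq q.1 | q : P <- s]).

Lemma ends_ofE s : ends_of s = [seq q.1 | q : P <- A :: rcons s B].
Proof. by rewrite /= map_rcons. Qed.

(** A one-entry tuple has length 0 and is excluded by [0 < l], so the initial [a] and the final [b]
    occupy different positions. *)
Lemma magnitude_simplex_ends L :
  magnitude_simplex l a b L -> exists m, L = ends m.
Proof.
case: L => // x L /and4P[/eqP -> Lb _ Ll].
case/lastP: L Lb Ll => [|m y].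
  by rewrite total_dist1 lt_eqF.
by rewrite last_rcons => /eqP -> _; exists m.
Qed.

Lemma light_seq_magnitude m : magnitude_simplex l a b (ends m) ->
  path (@light R X) A (rcons (light_seq a 0 m) B) /\
  path <%O A (rcons (light_seq a 0 m) B).
Proof.
move=> /and4P[_ _ mp /eqP ml].
have [u mE] := light_seq_rcons a 0 m b.
have Alight := path_light_seq a 0 (rcons m b).
have Alt : path <%O A (light_seq a 0 (rcons m b)).
  by rewrite path_light_lt// map_light_seq.
have Ale := sub_path (fun x y => @ltW _ P x y) Alt.
(* The final time [u] of the lift equals the total length of the tuple, which is [l]. *)
suff ul : u = l by rewrite mE ul in Alight Alt.
have := total_dist_light Ale; rewrite Alight map_cons map_light_seq ml mE.
by rewrite last_rcons subr0 => /eqP.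
Qed.

Lemma path_light_ends s : path <%O A (rcons s B) ->
  path (@light R X) A (rcons s B) = (total_dist (ends_of s) == l).
Proof.
move=> /(sub_path (fun x y => @ltW _ P x y)) /total_dist_light <-.
by rewrite -ends_ofE last_rcons subr0.
Qed.

Lemma total_dist_ends_le s : path <%O A (rcons s B) ->
  total_dist (ends_of s) <= l.
Proof.
move=> /(sub_path (fun x y => @ltW _ P x y)) /total_dist_causal [+ _].
by rewrite -ends_ofE last_rcons subr0.
Qed.

Lemma Cau_between (p : P) : (A <= p)%O -> (p <= B)%O -> Cau l a b p.
Proof.
rewrite /Order.le /= /causal_le /= subr0 => ap pb; split=> //.
by rewrite (le_trans _ ap) ?mdist_ge0//= -subr_ge0 (le_trans _ pb)// mdist_ge0.
Qed.

Lemma ordered_simplexP s :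
  reflect (sorted <%O s /\ forall p, p \in s -> calK l a b p)
    (ordered_simplex (pair_total K) s).
Proof.
apply: (iffP andP) => [[ss /asboolP[_ [sK _]]]|[ss sK]].
  by split=> // p ps; apply: sK; rewrite in_vertices.
split=> //; apply/asboolP; split=> //; split=> [p|p q].
  by rewrite in_vertices => /sK.
by rewrite !in_vertices; exact: lt_sorted_comparable.
Qed.

Lemma ordered_simplex_path s : ordered_simplex (pair_total K) s ->
  path <%O A (rcons s B).
Proof. by move=> /ordered_simplexP[ss sK]; exact: path_calK. Qed.

(** The completed chain is itself the light-like sequence witnessing that its entries lie in
    [Cau_ess]; strictness keeps those of [s] away from [A] and [B]. *)
Lemma path_light_ordered s : path (@light R X) A (rcons s B) ->
  path <%O A (rcons s B) -> ordered_simplex (pair_total K) s.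
Proof.
move=> slight slt; have AB := AB_lt l_gt0 dab_le_l.
(* In pairwise form, sortedness compares every entry with both ends, not only neighbours. *)
have /and5P[_ /allP As /allP sB sp _] :
    [&& true, all (<%O A) s, all (<%O^~ B) s, pairwise <%O s & true].
  move: slt; rewrite -[path _ _ _]/(sorted <%O (A :: rcons s B)).
  rewrite lt_sorted_pairwise pairwise_cons pairwise_rcons all_rcons.
  by move=> /and3P[/andP[_ ->] -> ->].
apply/ordered_simplexP; split=> [|p ps]; first by rewrite lt_sorted_pairwise.
split; last first.
  move=> [pA|pB]; first by have := As p ps; rewrite pA ltxx.
  by have := sB p ps; rewrite pB ltxx.
exists (A :: rcons s B); last by rewrite inE mem_rcons inE ps !orbT.
split=> //; last by rewrite last_rcons !eqxx.
move=> q; rewrite inE mem_rcons inE => /or3P[/eqP->|/eqP->|qs].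
- by apply: Cau_between => //; exact: ltW.
- by apply: Cau_between => //; exact: ltW.
- by apply: Cau_between; apply/ltW; [exact: As|exact: sB].
Qed.

(** Length [l] makes the completed strict chain light-like, and then consecutive points differ
    automatically. *)
Lemma magnitude_simplex_ordered s : ordered_simplex (pair_total K) s ->
  magnitude_simplex l a b (ends_of s) = (total_dist (ends_of s) == l).
Proof.
move=> /ordered_simplex_path slt; rewrite -path_light_ends//.
transitivity (path (fun y z : X => y != z) a (rcons [seq q.1 | q : P <- s] b) &&
    path (@light R X) A (rcons s B)).
  by rewrite path_light_ends// /magnitude_simplex /ends eqxx last_rcons eqxx.
apply: andb_idl => /path_light_lt.
by rewrite slt map_rcons => <-.
Qed.

Lemma K'_vertices s : ordered_simplex (pair_total K) s ->
  simplices (pair_sub K) (vertices s) <-> total_dist (ends_of s) < l.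
Proof.
move=> /andP[ss /asboolP Ks]; rewrite /= /K'_simplices /=.
by rewrite chain_points_vertices//; split=> [[]|].
Qed.

End LightChains.

HB.instance Definition _ (T : choiceType) (M : lmodType int) (u : T -> M) :=
  GRing.isZmodMorphism.Build {freeg T / int} M (fglift u) (lift_is_additive u).

(** Integer coefficients are iterated sums, which additive maps preserve. *)
Lemma freeg_additive_ext (T : choiceType) (V : zmodType)
    (u v : {additive {freeg T / int} -> V}) :
  (forall g, u << g >> = v << g >>) -> u =1 v.
Proof.
move=> uv c; rewrite -[c]freeg_sumE !raddf_sum; apply: eq_bigr => g _.
by rewrite -[coeff g c]intz -freegU_mulz !raddfMz uv.
Qed.

Lemma fglift_coeffE (T : choiceType) (M : lmodType int) (u : T -> M)
    (c : {freeg T / int}) :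
  fglift u c = \sum_(g <- dom c) coeff g c *: u g.
Proof.
rewrite -{1}[c]freeg_sumE raddf_sum; apply: eq_bigr => g _.
by rewrite /= liftU.
Qed.

Lemma seq_chainE (T : choiceType) (G : pred (seq T)) n (g : generator G n) :
  seq_chain G n (val g) = << g >>.
Proof. by rewrite /seq_chain valK. Qed.

Lemma seq_chain_eq0 (T : choiceType) (G : pred (seq T)) n (s : seq T) :
  ~~ G s -> seq_chain G n s = 0.
Proof. by move=> Gs; rewrite /seq_chain insubF// (negbTE Gs). Qed.

Lemma seq_chain_size (T : choiceType) (G : pred (seq T)) n (s : seq T) :
  (size s)%:Z != n + 1 -> seq_chain G n s = 0.
Proof. by move=> /negbTE sn; rewrite /seq_chain insubF// sn andbF. Qed.

(** * Relative chains of the pair (K, K') and magnitude chains *)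

Section ChainIso.
Variables (R : realType) (X : metricType R) (l : R) (a b : X).
Hypotheses (l_gt0 : 0 < l) (dab_le_l : mdist a b <= l).
Local Notation P := (causal_space X).
Local Notation K := (K_pair l a b).
Local Notation mag := (magnitude_simplex l a b).
Local Notation ord := (ordered_simplex (pair_total K)).
Local Notation ends_of s := (ends a b [seq q.1 | q : P <- s]).
Local Open Scope quotient_scope.

(** [seq_chain] gives 0 on sequences that are not generators, so simplices whose completion is
    shorter than [l] are killed. These are the simplices of K', whence the factorization through the
    relative chains. *)
Definition add_ends i j :
    {freeg (generator ord j)} -> {freeg (generator mag i)} :=
  fglift (fun g => seq_chain mag i (ends_of (val g))).
HB.instance Definition _ i j := GRing.Additive.on (@add_ends i j).

Lemma size_ends m : size (ends a b m) = (size m).+2.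
Proof. by rewrite /= size_rcons. Qed.

Lemma add_ends_seq_chain i j s : i = j + 2 -> ord s ->
  add_ends i (seq_chain ord j s) = seq_chain mag i (ends_of s).
Proof.
move=> ij os; rewrite {1}/seq_chain; case: insubP => [g _ gs|/=].
  by rewrite /add_ends liftU scale1r gs.
rewrite os /= => sj; rewrite raddf0 seq_chain_size// size_ends size_map.
by apply: contra sj => /eqP sj; apply/eqP; lia.
Qed.

Lemma add_ends_sub i j c : c \in @sub_chains _ _ K j -> add_ends i c = 0.
Proof.
move=> /sub_chainsP cK; rewrite /add_ends fglift_coeffE big_seq.
rewrite big1// => g /cK gK.
have /andP[og _] := valP g.
rewrite seq_chain_eq0 ?scaler0// magnitude_simplex_ordered// lt_eqF//.
exact/K'_vertices.
Qed.

Definition relative_add_ends i j :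
    relative_chains K j -> {freeg (generator mag i)} :=
  quot_lift (@add_ends_sub i j).
HB.instance Definition _ i j := GRing.Additive.on (@relative_add_ends i j).

Lemma relative_add_ends_pi i j c :
  relative_add_ends i (\pi_(relative_chains K j) c) = add_ends i c.
Proof. exact: quot_lift_pi. Qed.

(** On [ends a b m] the nested [behead] and [belast] return [m]; [light_seq] then restores the
    times. *)
Definition remove_ends i j :
    {freeg (generator mag i)} -> {freeg (generator ord j)} :=
  fglift (fun g => seq_chain ord j
    (light_seq a 0 (behead (belast a (behead (val g)))))).
HB.instance Definition _ i j := GRing.Additive.on (@remove_ends i j).

Lemma remove_ends_seq_chain i j m : i = j + 2 -> mag (ends a b m) ->
  remove_ends j (seq_chain mag i (ends a b m)) =
  seq_chain ord j (light_seq a 0 m).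
Proof.
move=> ij om; rewrite {1}/seq_chain; case: insubP => [g _ gs|].
  by rewrite /remove_ends liftU scale1r gs /= belast_rcons.
rewrite om size_ends => sj; rewrite raddf0 seq_chain_size//.
rewrite -(size_map (fun q : P => q.1)) map_light_seq.
by apply: contra sj => /eqP sj; apply/eqP; lia.
Qed.

Lemma remove_endsK i j : i = j + 2 ->
  cancel (@remove_ends i j) (@add_ends i j).
Proof.
move=> ij c; apply: (freeg_additive_ext
  (u := @add_ends i j \o @remove_ends i j) (v := idfun)).
move=> g /=; rewrite -seq_chainE; have /andP[og _] := valP g.
have [m gm] := magnitude_simplex_ends l_gt0 og; rewrite gm in og *.
have [slight slt] := light_seq_magnitude og.
rewrite remove_ends_seq_chain// add_ends_seq_chain ?map_light_seq//.
exact: path_light_ordered slt.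
Qed.

Definition relative_remove_ends i j :
    {freeg (generator mag i)} -> relative_chains K j :=
  \pi_(relative_chains K j) \o @remove_ends i j.
HB.instance Definition _ i j := GRing.Additive.on (@relative_remove_ends i j).

Lemma relative_remove_endsK i j : i = j + 2 ->
  cancel (@relative_remove_ends i j) (@relative_add_ends i j).
Proof.
move=> ij c; rewrite [relative_remove_ends _ _]/= relative_add_ends_pi.
exact: remove_endsK.
Qed.

Lemma relative_chain_surj j (q : relative_chains K j) :
  exists c, q = \pi_(relative_chains K j) c.
Proof. by exists (repr q); rewrite reprK. Qed.

Lemma relative_chain_eq0 j c :
  c \in @sub_chains _ _ K j -> \pi_(relative_chains K j) c = 0.
Proof.
move=> cK; rewrite -(raddf0 (\pi_(relative_chains K j))); apply/eqP.
by rewrite -ring_quotient.Quotient.idealrBE subr0.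
Qed.

(** This composite is the identity only modulo K'. A simplex with light-like completion is recovered
    from its points; any other has a short completion, is sent to 0, and has class 0. *)
Lemma relative_add_endsK i j : i = j + 2 ->
  cancel (@relative_add_ends i j) (@relative_remove_ends i j).
Proof.
move=> ij q; have [c ->] := relative_chain_surj q.
rewrite relative_add_ends_pi; move: c; apply: (freeg_additive_ext
  (u := @relative_remove_ends i j \o @add_ends i j)
  (v := \pi_(relative_chains K j))).
move=> g /=; rewrite -seq_chainE.
have /andP[og _] := valP g; have slt := ordered_simplex_path l_gt0 dab_le_l og.
rewrite add_ends_seq_chain//.
have [sl|sl] := boolP (mag (ends_of (val g))).
  rewrite /relative_remove_ends /= remove_ends_seq_chain//.
  rewrite (_ : light_seq _ _ _ = val g)//.
  rewrite magnitude_simplex_ordered// -path_light_ends// rcons_path in sl.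
  by have /andP[/light_seqK] := sl.
rewrite seq_chain_eq0// raddf0; symmetry; apply: relative_chain_eq0.
rewrite seq_chainE; apply/sub_chainsP => h; rewrite domU1 inE => /eqP ->.
apply/K'_vertices => //; rewrite lt_neqAle total_dist_ends_le// andbT.
by rewrite -magnitude_simplex_ordered.
Qed.

Lemma delete_ends p m : (p < size m)%N ->
  delete p.+1 (ends a b m) = ends a b (delete p m).
Proof.
move=> pm; rewrite /ends /delete /=; congr (_ :: _).
by rewrite drop_rcons// rcons_cat -cats1 takel_cat// ltnW.
Qed.

Lemma map_delete (T U : Type) (f : T -> U) p (s : seq T) :
  map f (delete p s) = delete p (map f s).
Proof. by rewrite /delete map_cat map_take map_drop. Qed.

(** Deleting entry [p] of [s] is deleting entry [p.+1] of the completed tuple, whose ends are never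
    deleted; the shift of index produces the sign. *)
Lemma add_ends_diff i j i' j' (c : simplicial_chains (pair_total K) j) :
  i = j + 2 -> i' = j' + 2 ->
  add_ends i' (differential (simplicial_chains (pair_total K)) j j' c) =
  - differential (magnitude_chains l a b) i i' (add_ends i c).
Proof.
move=> ij ij'; move: c; apply: (freeg_additive_ext
  (u := @add_ends i' j' \o differential (simplicial_chains (pair_total K)) j j')
  (v := -%R \o differential (magnitude_chains l a b) i i' \o @add_ends i j)).
move=> g /=; have /andP[og /eqP szg] := valP g.
rewrite -seq_chainE add_ends_seq_chain// !alt_diff_seq_chain//; first last.
- by rewrite size_ends size_map; move: (size _) szg => N szg; lia.
(* If a face already has length [l], so has the whole tuple: deletion does not increase length, and
   [l] is an upper bound. *)
- case=> // p; rewrite size_ends size_map => /andP[_ ps].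
  rewrite delete_ends ?size_map; last by lia.
  rewrite -map_delete !magnitude_simplex_ordered//; last first.
    exact: ordered_simplex_delete.
  move=> /eqP dl; rewrite eq_le total_dist_ends_le//=; last first.
    exact: ordered_simplex_path.
  rewrite -{1}dl /ends total_dist_subseq_cons// -!cats1 cat_subseq//.
  by rewrite map_subseq// delete_subseq.
rewrite raddf_sum size_ends size_map subn1 subn0 big_add1 /= -sumrN.
apply: eq_big_nat => p /andP[_ ps].
rewrite raddfZsign [X in _ *: X = _](add_ends_seq_chain ij'); last first.
  exact: ordered_simplex_delete.
by rewrite map_delete delete_ends ?size_map// exprS mulN1r scaleNr opprK.
Qed.

Lemma relative_add_ends_diff i j i' j' (q : relative_chains K j) :
  i = j + 2 -> i' = j' + 2 ->
  relative_add_ends i' (differential (relative_chains K) j j' q) =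
  - differential (magnitude_chains l a b) i i' (relative_add_ends i q).
Proof.
move=> ij ij'; have [c ->] := relative_chain_surj q.
rewrite [differential _ _ _ _](quotient_diff_pi (@sub_chains_diff _ _ K)).
rewrite !relative_add_ends_pi; exact: add_ends_diff.
Qed.

Lemma magnitude_relative_homology (k : int) :
  isomorphic_groups (magnitude_homology l a b k)
    (relative_homology K (k - 2)).
Proof.
apply: (isomorphic_homology (C := magnitude_chains l a b)
  relative_remove_endsK relative_add_endsK relative_add_ends_diff).
by rewrite subrK.
Qed.

End ChainIso.

Theorem theorem4p21 (R : realType) (X : metricType R) (a b : X) (l : R)
    (l_gt0 : 0 < l) (dab_le_l : mdist a b <= l) :
  [/\ (Cau_ess l a b !=set0 ->
        pair_homotopy_equivalent R
          (realization_pair R (Cau_ess_pair l a b))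
          (realization_pair R (suspension (suspension (K_pair l a b))))),
      (Cau_ess l a b = set0 ->
        pair_homotopy_equivalent R
          (pointed_quotient (realization_pair R (Cau_ess_pair l a b)))
          (pointed_quotient
             (realization_pair R (suspension (suspension (K_pair l a b)))))) &
      forall k : nat,
        isomorphic_groups (magnitude_homology l a b k%:Z)
          (relative_homology (K_pair l a b) (k%:Z - 2))].
Proof.
split.
- exact: Cau_ess_pair_suspension.
- exact: degenerate_quotients.
- by move=> k; exact: magnitude_relative_homology.
Qed.
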